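(* Let $0<\Phi<2\pi$ and $\hbar>0$. For every $n_\phi\in\{1,2,3,\ldots\}$, let $$u_{n_\phi}(\phi)=\sqrt{\tfrac{2}{\Phi}}\,\sin\!\left(\frac{n_\phi\pi\phi}{\Phi}\right),\qquad 0\le\phi\le\Phi,$$ be the $n_\phi$-th azimuthal state of the spherical wedge of azimuthal extent $\Phi$. Then the uncertainty of $L_z$ in this state is $$\Delta L_z=\frac{\hbar\,n_\phi\pi}{\Phi},$$ and in particular it is non-zero for every $n_\phi$.
   Context: The spherical wedge of azimuthal extent $\Phi$ and radius $R>0$ is $\{(r,\theta,\phi):0\le r\le R,\ 0\le\theta\le\pi,\ 0\le\phi\le\Phi\}$ in spherical coordinates, with Dirichlet conditions imposed on its boundary. Its azimuthal states $u_{n_\phi}$ are the $L^2([0,\Phi])$-normalised solutions of $u''+\mu^2u=0$, $u(0)=u(\Phi)=0$, which have $\mu=n_\phi\pi/\Phi$. The operator $\hat L_z=-i\hbar\,d/d\phi$ acts as a differential expression, so $\hat L_z^2=-\hbar^2\,d^2/d\phi^2$. For a state $u$, set $\langle L_z\rangle=\int_0^\Phi\overline{u}\,\hat L_zu\,d\phi$, $\langle L_z^2\rangle=\int_0^\Phi\overline{u}\,\hat L_z^2u\,d\phi$, and $\Delta L_z=\sqrt{\langle L_z^2\rangle-\langle L_z\rangle^2}$. *)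

(* Defs.v *)
From Stdlib Require Import Reals Lra.
From Coquelicot Require Import Coquelicot.
Open Scope R_scope.

(** Complex-valued functions of a real variable are differentiated and
    integrated in [C] seen as a normed module over [R].  Coquelicot has no
    total derivative operator for such functions, hence [CDerive]. *)
Definition CDerive (f : R -> C) (x : R) : C :=
  (Derive (fun t => Re (f t)) x, Derive (fun t => Im (f t)) x).

Lemma is_derive_CDerive (f : R -> C) (x : R) (l : C) :
  is_derive (V := C_R_NormedModule) f x l -> CDerive f x = l.
Proof.
intros H. destruct l as [a b]. unfold CDerive. f_equal; apply is_derive_unique.
- exact (filterdiff_comp f fst _ fst H (filterdiff_linear _ is_linear_fst)).
- exact (filterdiff_comp f snd _ snd H (filterdiff_linear _ is_linear_snd)).
Qed.

Definition CRInt (f : R -> C) (a b : R) : C :=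
  RInt (V := C_R_CompleteNormedModule) f a b.

(** Principal square root (nonnegative real part; [+ i sqrt (- x)] for a
    negative real [x]). *)
Definition Csqrt (z : C) : C :=
  (sqrt ((Cmod z + Re z) / 2),
   if Rlt_dec (Im z) 0 then - sqrt ((Cmod z - Re z) / 2)
   else sqrt ((Cmod z - Re z) / 2)).

Lemma Csqrt_sqr (z : C) : (Csqrt z * Csqrt z)%C = z.
Proof.
destruct z as [x y].
assert (Hm : Cmod (x, y) * Cmod (x, y) = x * x + y * y).
{ unfold Cmod; cbn [fst snd]. rewrite sqrt_sqrt; [ring | nra]. }
assert (H0 := Cmod_ge_0 (x, y)).
assert (Hx : Rabs x <= Cmod (x, y)).
{ rewrite <- (Rabs_pos_eq _ H0). apply Rsqr_le_abs_0. unfold Rsqr. nra. }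
unfold Csqrt; cbn [Re Im fst snd].
set (m := Cmod (x, y)) in *.
assert (Hx1 := Rle_abs x). assert (Hx2 := Rle_abs (- x)).
rewrite Rabs_Ropp in Hx2.
assert (Hp : 0 <= (m + x) / 2) by lra.
assert (Hq : 0 <= (m - x) / 2) by lra.
assert (Sp := sqrt_sqrt _ Hp). assert (Sq := sqrt_sqrt _ Hq).
assert (Hpq : sqrt ((m + x) / 2) * sqrt ((m - x) / 2) = Rabs y / 2).
{ rewrite <- sqrt_mult by assumption.
  replace ((m + x) / 2 * ((m - x) / 2)) with (Rsqr (y / 2))
    by (unfold Rsqr; nra).
  rewrite sqrt_Rsqr_abs. unfold Rdiv. rewrite Rabs_mult, (Rabs_pos_eq (/ 2)); lra. }
unfold Cmult; cbn [fst snd].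
destruct (Rlt_dec y 0) as [Hy | Hy].
- rewrite Rabs_left in Hpq by lra. f_equal; lra.
- rewrite Rabs_pos_eq in Hpq by lra. f_equal; lra.
Qed.

(** [u] is an [L^2([0,Phi])]-normalised solution of [u'' + mu^2 u = 0] with
    [u(0) = u(Phi) = 0]. *)
Definition azimuthal_state (Phi mu : R) (u : R -> C) : Prop :=
  continuous_on (fun phi => 0 <= phi <= Phi) u /\
  (forall phi, 0 < phi < Phi ->
     ex_derive (V := C_R_NormedModule) u phi /\
     ex_derive (V := C_R_NormedModule) (CDerive u) phi /\
     (CDerive (CDerive u) phi + RtoC mu ^ 2 * u phi)%C = 0%C) /\
  u 0 = 0%C /\ u Phi = 0%C /\
  is_RInt (fun phi => Cmod (u phi) ^ 2) 0 Phi 1.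

(** Only the values on [[0,Phi]] matter below; the formula is used on all of
    [R] so that ordinary two-sided derivatives apply at the endpoints. *)
Definition wedge_u (Phi : R) (n : nat) (phi : R) : C :=
  RtoC (sqrt (2 / Phi) * sin (INR n * PI * phi / Phi)).

Definition Lz (hbar : R) (f : R -> C) (phi : R) : C :=
  (- Ci * RtoC hbar * CDerive f phi)%C.

Definition expectation (Phi : R) (A : (R -> C) -> R -> C) (u : R -> C) : C :=
  CRInt (fun phi => Cconj (u phi) * A u phi)%C 0 Phi.

(** The second moment is [<u, Lz (Lz u)>], with [Lz] a differential
    expression; it is not [||Lz u||^2].  Since [Lz] is not symmetric on
    arbitrary [u], the variance is a priori complex. *)
Definition variance_Lz (hbar Phi : R) (u : R -> C) : C :=
  (expectation Phi (fun f => Lz hbar (Lz hbar f)) u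
   - expectation Phi (Lz hbar) u ^ 2)%C.

Definition Delta_Lz (hbar Phi : R) (u : R -> C) : C :=
  Csqrt (variance_Lz hbar Phi u).

(* Main.v *)
(** For a real [u], the integrand of [<L_z>] is [- i hbar u u'], an exact
    derivative, so [<L_z>] vanishes by the Dirichlet conditions.  The state is an
    eigenfunction of [L_z^2] with eigenvalue [(hbar n pi / Phi)^2], so this
    is the whole variance. *)
Require Import Defs.
From Stdlib Require Import Reals Lra.
From Coquelicot Require Import Coquelicot.
Open Scope R_scope.

(** [RtoC y] is the real scalar [y] acting on the fixed vector [1], so the rule for a scalar
    function times a constant vector applies. *)
Lemma is_derive_RtoC (g : R -> R) (x l : R) :
  is_derive g x l ->
  is_derive (V := C_R_NormedModule) (fun t => RtoC (g t)) x (RtoC l).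
Proof.
intros H.
assert (E : forall y : R, scal (V := C_R_NormedModule) y (RtoC 1) = RtoC y).
{ intros y. unfold scal; simpl. unfold prod_scal, scal; simpl.
  unfold mult; simpl. unfold RtoC; f_equal; ring. }
rewrite <- E.
apply (is_derive_ext (V := C_R_NormedModule) _ _ _ _ (fun t => E (g t))).
exact (is_derive_scal_l (V := C_R_NormedModule) g x l (RtoC 1) H).
Qed.

(** Both expectations have an integrand of this shape. The real and imaginary parts of [c] scale the
    same real integral, component by component. *)
Lemma is_RInt_scal_RtoC (c : C) (f : R -> R) (a b l : R) :
  is_RInt f a b l ->
  is_RInt (V := C_R_NormedModule) (fun t => (c * RtoC (f t))%C) a b
    (c * RtoC l)%C.
Proof.
intros H.
assert (E : forall y, (c * RtoC y)%C = (fst c * y, snd c * y))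
  by (intros y; unfold Cmult; simpl; f_equal; ring).
rewrite E.
apply (is_RInt_ext (V := C_R_NormedModule) (fun t => (fst c * f t, snd c * f t)))
  ; [intros t _; now rewrite E|].
apply (is_RInt_fct_extend_pair (U := R_NormedModule) (V := R_NormedModule)).
- exact (is_RInt_scal f a b (fst c) l H).
- exact (is_RInt_scal f a b (snd c) l H).
Qed.

Lemma CDerive_ext (f g : R -> C) (x : R) :
  (forall t, f t = g t) -> CDerive f x = CDerive g x.
Proof.
intros H; unfold CDerive; f_equal; apply Derive_ext; intros t; now rewrite H.
Qed.

Lemma CDerive_scal_RtoC (c : C) (g : R -> R) (x : R) :
  CDerive (fun t => (c * RtoC (g t))%C) x = (c * RtoC (Derive g x))%C.
Proof.
unfold CDerive.
rewrite (Derive_ext _ (fun t => Re c * g t))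
  by (intros t; unfold Re; simpl; ring).
rewrite (Derive_ext (fun t => Im _) (fun t => Im c * g t))
  by (intros t; unfold Im; simpl; ring).
rewrite !Derive_scal. unfold Re, Im, Cmult; simpl. f_equal; ring.
Qed.

Lemma CDerive_RtoC (g : R -> R) (x : R) :
  CDerive (fun t => RtoC (g t)) x = RtoC (Derive g x).
Proof.
rewrite (CDerive_ext _ (fun t => (1 * RtoC (g t))%C))
  by (intros t; now rewrite Cmult_1_l).
rewrite CDerive_scal_RtoC. apply Cmult_1_l.
Qed.

Lemma Lz_RtoC (hbar : R) (g : R -> R) (x : R) :
  Lz hbar (fun t => RtoC (g t)) x = (- Ci * RtoC hbar * RtoC (Derive g x))%C.
Proof. unfold Lz; now rewrite CDerive_RtoC. Qed.

(** The constant [- i hbar] left by the inner [Lz] passes through the outer derivative, and its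
    square is the real number [- hbar ^ 2]. *)
Lemma Lz_Lz_RtoC (hbar : R) (g : R -> R) (x : R) :
  Lz hbar (Lz hbar (fun t => RtoC (g t))) x
  = RtoC (- hbar ^ 2 * Derive (Derive g) x).
Proof.
unfold Lz at 1.
rewrite (CDerive_ext _ _ x (Lz_RtoC hbar g)), CDerive_scal_RtoC.
unfold Ci, RtoC, Cmult, Copp; simpl. f_equal; ring.
Qed.

Lemma Cconj_RtoC (x : R) : Cconj (RtoC x) = RtoC x.
Proof. unfold Cconj, RtoC; simpl; now rewrite Ropp_0. Qed.

(* [g g'] is the derivative of [g^2 / 2]. *)
Lemma expectation_Lz_RtoC (hbar Phi : R) (g g' : R -> R) :
  (forall x, is_derive g x (g' x)) -> (forall x, continuous g' x) ->
  g 0 ^ 2 = g Phi ^ 2 ->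
  expectation Phi (Lz hbar) (fun t => RtoC (g t)) = 0%C.
Proof.
intros Hg Hc Hb. unfold expectation, CRInt.
assert (Hint : is_RInt (fun t => g t * g' t) 0 Phi 0).
{ replace 0 with (minus (g Phi ^ 2 / 2) (g 0 ^ 2 / 2)) at 2
    by (unfold minus, plus, opp; simpl in *; lra).
  apply (is_RInt_derive (fun t => g t ^ 2 / 2)).
  - intros x _. auto_derive.
    + now exists (g' x).
    + replace (Derive _ x) with (g' x)
        by (symmetry; now apply is_derive_unique).
      field.
  - intros x _. apply (continuous_mult g g').
    + apply (ex_derive_continuous g). now exists (g' x).
    + apply Hc. }
transitivity ((- Ci * RtoC hbar) * RtoC 0)%C; [|ring].
apply (is_RInt_unique (V := C_R_CompleteNormedModule)).
apply (is_RInt_ext (V := C_R_NormedModule)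
  (fun t => ((- Ci * RtoC hbar) * RtoC (g t * g' t))%C)).
- intros t _. rewrite Cconj_RtoC, Lz_RtoC.
  rewrite (is_derive_unique g t (g' t)) by apply Hg.
  rewrite RtoC_mult.
  (* The equation lives in the carrier of the normed module; [ring] has to see it in [C]. *)
  match goal with |- ?a = ?b => change (@eq C a b) end. ring.
- now apply is_RInt_scal_RtoC.
Qed.

(** The signs of [- hbar ^ 2] and [- k ^ 2] cancel, so the integrand is the eigenvalue times
    [g ^ 2], whose integral is the squared norm [N]. *)
Lemma expectation_Lz_Lz_RtoC (hbar Phi k N : R) (g : R -> R) :
  (forall x, Derive (Derive g) x = - k ^ 2 * g x) ->
  is_RInt (fun t => g t ^ 2) 0 Phi N ->
  expectation Phi (fun f => Lz hbar (Lz hbar f)) (fun t => RtoC (g t))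
  = RtoC ((hbar * k) ^ 2 * N).
Proof.
intros Hg HN. unfold expectation, CRInt.
apply (is_RInt_unique (V := C_R_CompleteNormedModule)).
rewrite RtoC_mult.
apply (is_RInt_ext (V := C_R_NormedModule)
  (fun t => (RtoC ((hbar * k) ^ 2) * RtoC (g t ^ 2))%C)).
- intros t _. rewrite Cconj_RtoC, Lz_Lz_RtoC, Hg, <- !RtoC_mult.
  f_equal; ring.
- now apply is_RInt_scal_RtoC.
Qed.

(** Modulus and real part of [x ^ 2] coincide, so the half-difference under the second root
    vanishes; the sign of [x] makes it the principal root. *)
Lemma Csqrt_RtoC_sqr (x : R) : 0 <= x -> Csqrt (RtoC (x ^ 2)) = RtoC x.
Proof.
intros Hx. unfold Csqrt. rewrite Cmod_R, Rabs_pos_eq by apply pow2_ge_0.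
unfold Re, Im, RtoC; simpl.
destruct (Rlt_dec 0 0) as [H | _]; [lra|].
replace ((x * (x * 1) + x * (x * 1)) / 2) with (x * x) by field.
replace ((x * (x * 1) - x * (x * 1)) / 2) with 0 by field.
now rewrite sqrt_square, sqrt_0.
Qed.

Lemma is_derive_sin_scal (s k x : R) :
  is_derive (fun t => s * sin (k * t)) x (s * k * cos (k * x)).
Proof. auto_derive; [easy | ring]. Qed.

Lemma is_derive_cos_scal (s k x : R) :
  is_derive (fun t => s * k * cos (k * t)) x (- k ^ 2 * (s * sin (k * x))).
Proof. auto_derive; [easy | ring]. Qed.

Lemma Derive2_sin_scal (s k x : R) :
  Derive (Derive (fun t => s * sin (k * t))) x = - k ^ 2 * (s * sin (k * x)).
Proof.
rewrite (Derive_ext _ (fun t => s * k * cos (k * t)))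
  by (intros t; apply is_derive_unique, is_derive_sin_scal).
apply is_derive_unique, is_derive_cos_scal.
Qed.

Lemma is_RInt_sin_sqr (s k L : R) :
  k <> 0 -> sin (k * L) = 0 ->
  is_RInt (fun t => (s * sin (k * t)) ^ 2) 0 L (s ^ 2 * L / 2).
Proof.
intros Hk HL.
(* Antiderivative from the half-angle formula, with [sin (2 k t)] written as [2 sin cos]. Its
   oscillating term vanishes at both ends. *)
set (F t := s ^ 2 * (t / 2 - sin (k * t) * cos (k * t) / (2 * k))).
replace (s ^ 2 * L / 2) with (minus (F L) (F 0)).
2:{ unfold F, minus, plus, opp; simpl.
    rewrite HL, Rmult_0_r, sin_0. field; exact Hk. }
apply (is_RInt_derive F).
- intros x _. unfold F. auto_derive; [easy|].
  pose proof (sin2_cos2 (k * x)) as E; unfold Rsqr in E.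
  (* The two sides differ by a multiple of [1 - (sin ^ 2 + cos ^ 2)]; subtracting isolates the
     Pythagorean identity. *)
  apply Rminus_diag_uniq.
  match goal with |- ?a = 0 =>
    replace a with (s ^ 2 / 2 * (1 - (sin (k * x) * sin (k * x)
      + cos (k * x) * cos (k * x)))) by (field; exact Hk) end.
  rewrite E; ring.
- intros x _.
  apply (ex_derive_continuous (fun t => (s * sin (k * t)) ^ 2)).
  now auto_derive.
Qed.

Lemma sin_INR_PI (n : nat) : sin (INR n * PI) = 0.
Proof. rewrite INR_IZR_INZ; apply sin_eq_0_1; now eexists. Qed.

(** Gives the argument of the sine the form [k * t] used in the lemmas above. *)
Lemma wedge_u_eq (Phi : R) (n : nat) (t : R) :
  wedge_u Phi n t = RtoC (sqrt (2 / Phi) * sin (INR n * PI / Phi * t)).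
Proof.
unfold wedge_u; do 3 f_equal. unfold Rdiv; ring.
Qed.

Theorem mainTheorem3 :
  forall (Phi hbar : R), 0 < Phi < 2 * PI -> 0 < hbar ->
  forall n : nat, (1 <= n)%nat ->
    azimuthal_state Phi (INR n * PI / Phi) (wedge_u Phi n) /\
    Delta_Lz hbar Phi (wedge_u Phi n) = RtoC (hbar * INR n * PI / Phi) /\
    Delta_Lz hbar Phi (wedge_u Phi n) <> RtoC 0.
Proof.
intros Phi hbar [HPhi _] Hhbar n Hn.
assert (Hn0 : 0 < INR n) by now apply lt_0_INR.
pose proof PI_RGT_0 as HPI.
set (k := INR n * PI / Phi).
assert (Hk : 0 < k).
{ apply Rdiv_lt_0_compat; [apply Rmult_lt_0_compat|]; assumption. }
set (s := sqrt (2 / Phi)).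
set (g t := s * sin (k * t)).
(* An equality of functions, since [Delta_Lz] and [azimuthal_state] take the whole state as
   argument. *)
assert (Hu : wedge_u Phi n = fun t => RtoC (g t)).
{ apply FunctionalExtensionality.functional_extensionality; intros t.
  apply wedge_u_eq. }
assert (HkPhi : sin (k * Phi) = 0).
{ replace (k * Phi) with (INR n * PI) by (unfold k; field; lra).
  apply sin_INR_PI. }
assert (g0 : g 0 = 0) by (unfold g; rewrite Rmult_0_r, sin_0; ring).
assert (gPhi : g Phi = 0) by (unfold g; rewrite HkPhi; ring).
assert (HN : is_RInt (fun t => g t ^ 2) 0 Phi 1).
(* The amplitude [s] satisfies [s ^ 2 = 2 / Phi], which makes the norm 1. This serves both the
   second moment and the normalisation clause. *)
{ replace 1 with (s ^ 2 * Phi / 2).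
  - apply is_RInt_sin_sqr; [lra | exact HkPhi].
  - unfold s. rewrite pow2_sqrt; [field; lra|].
    apply Rlt_le, Rdiv_lt_0_compat; lra. }
assert (HD : Delta_Lz hbar Phi (wedge_u Phi n) = RtoC (hbar * k)).
{ unfold Delta_Lz, variance_Lz. rewrite Hu.
  rewrite (expectation_Lz_Lz_RtoC hbar Phi k 1 g)
    by (exact HN || apply Derive2_sin_scal).
  rewrite (expectation_Lz_RtoC hbar Phi g (fun t => s * k * cos (k * t))).
  - replace (RtoC ((hbar * k) ^ 2 * 1) - 0 ^ 2)%C with (RtoC ((hbar * k) ^ 2)).
    + apply Csqrt_RtoC_sqr. apply Rmult_le_pos; lra.
    + rewrite Rmult_1_r. ring.
  - apply is_derive_sin_scal.
  - intros x. apply (ex_derive_continuous (fun t => s * k * cos (k * t))).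
    eexists; apply is_derive_cos_scal.
  - now rewrite g0, gPhi. }
split; [|split].
- rewrite Hu.
  assert (Hg' : forall x, is_derive (V := C_R_NormedModule)
    (fun t => RtoC (g t)) x (RtoC (s * k * cos (k * x))))
    by (intros x; apply is_derive_RtoC, is_derive_sin_scal).
  split; [|split; [|split; [|split]]].
  + apply continuous_on_forall; intros x _.
    apply (ex_derive_continuous (V := C_R_NormedModule)).
    eexists; apply Hg'.
  + intros phi _; split; [|split].
    * eexists; apply Hg'.
    * exists (RtoC (- k ^ 2 * g phi)).
      (* [CDerive u] is replaced by its explicit cosine form, which can be differentiated once
         more. *)
      apply (is_derive_ext (V := C_R_NormedModule)
        (fun t => RtoC (s * k * cos (k * t)))).
      -- intros t; symmetry; apply is_derive_CDerive, Hg'.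
      -- apply is_derive_RtoC, is_derive_cos_scal.
    * rewrite (CDerive_ext _ _ phi (CDerive_RtoC g)), CDerive_RtoC.
      replace (Derive _ phi) with (- k ^ 2 * g phi)
        by (symmetry; apply Derive2_sin_scal).
      rewrite RtoC_mult, RtoC_opp, RtoC_pow. ring.
  + now rewrite g0.
  + now rewrite gPhi.
  + apply is_RInt_ext with (2 := HN). intros t _.
    now rewrite Cmod_R, pow2_abs.
- rewrite HD. f_equal. unfold k, Rdiv; ring.
(* By injectivity of [RtoC], a zero uncertainty would force [hbar * k = 0], but both factors are
   positive. *)
- rewrite HD. intros H. apply RtoC_inj in H.
  pose proof (Rmult_lt_0_compat _ _ Hhbar Hk). lra.
Qed.
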